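(* Let $G=(\mathrm G)$ be the Hessian group of order 648. With notation as in the context, $$\det M_0(t)=\frac{(1-t^3)^4(1-t^6)(1-t^9)}{1-t^{18}}\,\Delta^+_{2,3,3,3}(t^6),\qquad \det M(t)=\frac{(1-t^3)^4(1-t^6)(1-t^9)^2}{1-t^{18}}\,\Delta_{2,3,3,3}(t^6).$$
   Context: For a finite group $G\subset\mathrm{SL}_3(\mathbb{C})$: let $\gamma$ be its natural 3-dimensional representation, $\gamma^*$ the contragredient representation, $\gamma_0,\dots,\gamma_l$ the irreducible complex representations of $G$ with $\gamma_0$ trivial. Define $(l+1)\times(l+1)$ integer matrices $B=(b_{ij})$, $B^*=(b^*_{ij})$ by $\gamma_j\otimes\gamma=\bigoplus_i b_{ij}\gamma_i$, $\gamma_j\otimes\gamma^*=\bigoplus_i b^*_{ij}\gamma_i$. Let $M(t)=(1-t^3)I-tB+t^2B^*$ and let $M_0(t)$ be obtained from $M(t)$ by replacing the column indexed by $\gamma_0$ with $(1,0,\dots,0)^t$ ($\gamma_0$ first). For positive integers $\alpha_1,\dots,\alpha_m$ write $[\alpha]_t=(1-t^\alpha)/(1-t)$ and define $\Delta_{\alpha_1,\dots,\alpha_m}(t)=(1-t)^{2-m}\prod_{i=1}^m(1-t^{\alpha_i})$, $\Delta^+_{\alpha_1,\dots,\alpha_m}(t)=(1-2t-2t^2+t^3)\prod_{i=1}^m[\alpha_i]_t+t^2\sum_{i=1}^m[\alpha_i-1]_t\prod_{j\ne i}[\alpha_j]_t$. The group (G): with $\omega=e^{2\pi i/3}$, $S_1=\mathrm{diag}(1,\omega,\omega^2)$,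 $T_0=\begin{pmatrix}0&1&0\\0&0&1\\1&0&0\end{pmatrix}$, $V=\frac{1}{\sqrt{3}\,i}\begin{pmatrix}1&1&1\\1&\omega&\omega^2\\1&\omega^2&\omega\end{pmatrix}$, $U=\mathrm{diag}(\varepsilon,\varepsilon,\varepsilon\omega)$ with $\varepsilon^3=\omega^2$, (G) is the subgroup of $\mathrm{SL}_3(\mathbb{C})$ of order 648 generated by $S_1,T_0,V,U$. *)

(* Defs.v *)
From HB Require Import structures.
From mathcomp Require Import all_boot all_order all_algebra all_fingroup all_solvable all_field all_character.
Set Implicit Arguments. Unset Strict Implicit. Unset Printing Implicit Defensive.
Import Order.TTheory GRing.Theory Num.Theory.
Local Open Scope ring_scope.

(* Submonoid of 3x3 complex matrices generated by a list of matrices.  For a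
   finite set of generators generating a finite group this is the generated
   group (inverses are positive powers). *)
Inductive gen_by (gens : seq 'M[algC]_3) : 'M[algC]_3 -> Prop :=
| gen_by1 : gen_by gens 1%:M
| gen_byM : forall g h, g \in gens -> gen_by gens h -> gen_by gens (g *m h).

(* omega = e^{2 pi i/3}; sqrtC (-3) = i sqrt 3 (sqrtC has nonnegative imaginary part). *)
Definition omega : algC := (-1 + sqrtC (- 3%:R)) / 2%:R.

Definition HS1 : 'M[algC]_3 :=
  \matrix_(i < 3, j < 3) (if i == j then omega ^+ i else 0).
Definition HT0 : 'M[algC]_3 :=
  \matrix_(i < 3, j < 3) (if (j : nat) == ((i : nat).+1 %% 3)%N then 1 else 0).
Definition HV : 'M[algC]_3 :=
  (sqrtC (- 3%:R))^-1 *: \matrix_(i < 3, j < 3) omega ^+ (i * j).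
Definition HU (eps : algC) : 'M[algC]_3 :=
  \matrix_(i < 3, j < 3)
    (if i == j then (if (i : nat) == 2%N then eps * omega else eps) else 0).

Section Dual.
Variables (gT : finGroupType) (G : {group gT}) (n : nat).
Variable rho : mx_representation algC G n.

Definition dual_fun (g : gT) : 'M[algC]_n := (rho (g^-1)%g)^T.

Lemma dual_repr_proof : mx_repr G dual_fun.
Proof.
split; first by rewrite /dual_fun invg1 repr_mx1 trmx1.
move=> x y Gx Gy; rewrite /dual_fun invMg repr_mxM ?groupV // trmx_mul //.
Qed.

Definition dual_repr : mx_representation algC G n := MxRepresentation dual_repr_proof.
End Dual.

(* Multiplicity matrices:  gamma_j (x) gamma = (+)_i b_ij gamma_i  (via characters). *)
Definition Bmat (gT : finGroupType) (G : {group gT}) (n : nat)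
  (rho : mx_representation algC G n) : 'M[algC]_(Nirr G) :=
  \matrix_(i, j) '['chi[G]_j * cfRepr rho, 'chi[G]_i].

Definition Mmat (gT : finGroupType) (G : {group gT}) (n : nat)
  (rho : mx_representation algC G n) : 'M[{poly algC}]_(Nirr G) :=
  (1 - 'X^3)%:M - 'X *: map_mx polyC (Bmat rho)
    + 'X^2 *: map_mx polyC (Bmat (dual_repr rho)).

Definition M0mat (gT : finGroupType) (G : {group gT}) (n : nat)
  (rho : mx_representation algC G n) : 'M[{poly algC}]_(Nirr G) :=
  \matrix_(i, j) (if (j : nat) == 0%N then ((i : nat) == 0%N)%:R
                  else Mmat rho i j).

Definition qint (F : fieldType) (a : nat) (t : F) : F := (1 - t ^+ a) / (1 - t).

Definition Delta (F : fieldType) (al : seq nat) (t : F) : F :=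
  (1 - t) ^ (2%:Z - (size al)%:Z) * \prod_(a <- al) (1 - t ^+ a).

Definition DeltaP (F : fieldType) (al : seq nat) (t : F) : F :=
  (1 - 2%:R * t - 2%:R * t ^+ 2 + t ^+ 3) * \prod_(a <- al) qint a t
  + t ^+ 2 * \sum_(k < size al)
       (qint (nth 0%N al k).-1 t *
        \prod_(l < size al | l != k) qint (nth 0%N al l) t).

Notation "x %:F" := (@FracField.tofrac _ x) : ring_scope.
Definition Tf : {fraction {poly algC}} := FracField.tofrac ('X : {poly algC}).

(* Main.v *)
(** The columns of the character table [X] diagonalise the McKay matrices, so
[M(t)^T X = X diag(f_c)] where [f_c = 1 - chi(c) t + chi(c^-1) t^2 - t^3] runs over the
conjugacy classes [c]; hence [det M] is the product of the [f_c].  Since [chi_0 = 1], Cramer's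
rule turns the cofactor [det M_0] into [det M] times the Molien series
[1/|G| sum_g 1/f_g].  Both sides therefore only depend on the sizes and traces of the
conjugacy classes.

For these, [G] is enumerated.  If [eps^3 = omega^2], every element is [eps^j A] with [A] over
[Q(omega)], and the lattice of vectors with all coordinates congruent modulo [sqrt(-3)] is
stable under all the [A], so that [G] can be computed with in 3x3 matrices over [Z[omega]]
and [j] modulo 3.  There are 24 classes: multiplication by the centre [{1, omega, omega^2}]
permutes 21 of them in free orbits and fixes three, of trace 0.  The product and the sum over
a free orbit are rational functions of [q = t^3], which makes the final identity one between
rational functions of [q] alone. *)

From Stdlib Require Import ZArith.
Require Import Defs.
From HB Require Import structures.
From mathcomp Require Import all_boot all_order all_algebra all_fingroup all_solvable all_field all_character.
From mathcomp Require Import zify ssrZ ring.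
Set Implicit Arguments. Unset Strict Implicit. Unset Printing Implicit Defensive.
Import Order.TTheory GRing.Theory Num.Theory.
Local Open Scope ring_scope.

(** * Determinants of the McKay matrices *)

Lemma div_mul_swap (K : fieldType) (n g f P : K) :
  f != 0 -> n / g * P = n / f * (f * P / g).
Proof. by move=> f0; rewrite !mulrA divfK // mulrAC. Qed.

Section McKay.
Variables (gT : finGroupType) (G : {group gT}) (n : nat).
Variable rho : mx_representation algC G n.

Lemma cfRepr_dual g : g \in G -> cfRepr (dual_repr rho) g = cfRepr rho g^-1%g.
Proof. by move=> Gg; rewrite !cfunE groupV Gg /= /dual_fun mxtrace_tr. Qed.

(** The decomposition of ['chi_j * cfRepr rho] into irreducibles, evaluated at a representative of
    the class [c], is the entry [(j, c)]. *)
Lemma Bmat_character_table :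
  (Bmat rho)^T *m character_table G =
  character_table G *m diag_mx (\row_c cfRepr rho (repr (irr_class c))).
Proof.
apply/matrixP=> j c; rewrite mul_mx_diag !mxE -[RHS]/(_ * _).
under eq_bigr do rewrite !mxE.
have /cfunP/(_ (repr (irr_class c))) := cfun_sum_cfdot ('chi_j * cfRepr rho).
rewrite cfunE sum_cfunE => ->.
by apply: eq_bigr => i _; rewrite !cfunE.
Qed.

(** For [rho g] of size 3 and determinant 1 this is [det (1 - t g)], the second coefficient being
    the trace of the inverse. *)
Definition mckay_factor (g : gT) : {poly algC} :=
  1 - 'X^3 - (cfRepr rho g) *: 'X + (cfRepr rho g^-1%g) *: 'X^2.

Lemma mckay_factorJ : {in G &, forall g h, mckay_factor (g ^ h)%g = mckay_factor g}.
Proof. by move=> g h Gg Gh; rewrite /mckay_factor -conjVg !cfunJ. Qed.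

Lemma mckay_factor_neq0 g : mckay_factor g != 0.
Proof.
apply/eqP=> /(congr1 (fun p : {poly algC} => p`_0)) /eqP.
by rewrite !coefE /= !mulr0 !subr0 addr0 oner_eq0.
Qed.

End McKay.

Section Determinants.
Variables (gT : finGroupType) (G : {group gT}) (n : nat).
Variable rho : mx_representation algC G n.

Let XP : 'M[{poly algC}]_(Nirr G) := map_mx polyC (character_table G).
Let F c := mckay_factor rho (repr (irr_class (c : Iirr G))).

Lemma Mmat_character_table :
  (Mmat rho)^T *m XP = XP *m diag_mx (\row_c F c).
Proof.
have map_diag (r : mx_representation algC G n) :
  (map_mx polyC (Bmat r))^T *m XP =
  XP *m diag_mx (\row_c (cfRepr r (repr (irr_class c)))%:P).
  rewrite map_trmx -map_mxM Bmat_character_table map_mxM map_diag_mx.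
  by congr (_ *m diag_mx _); apply/rowP=> c; rewrite !mxE.
rewrite /Mmat !linearD /= linearN /= !linearZ /= tr_scalar_mx !mulmxDl.
rewrite scalerN mulNmx -!scalemxAl.
rewrite !map_diag mul_scalar_mx; apply/matrixP=> j c.
rewrite !mul_mx_diag !mxE /F /mckay_factor cfRepr_dual; last first.
  by have /repr_classesP[] := irr_classP c.
by rewrite -!mul_polyC; ring.
Qed.

Lemma det_character_table_neq0 : \det XP != 0.
Proof.
rewrite det_map_mx polyC_eq0 -unitfE -unitmxE; exact: character_table_unit.
Qed.

Lemma det_Mmat :
  \det (Mmat rho) = \prod_(C in classes G) mckay_factor rho (repr C).
Proof.
have /(congr1 determinant) := Mmat_character_table.
rewrite !det_mulmx det_tr mulrC => /(mulfI det_character_table_neq0) ->.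
by rewrite det_diag reindex_irr_class; apply: eq_bigr => c _; rewrite mxE.
Qed.

Lemma det_M0mat :
  (\det (M0mat rho))%:F = (\det (Mmat rho))%:F *
    ((#|G|%:R)^-1 * \sum_(g in G) ((mckay_factor rho g)%:F)^-1).
Proof.
set d := \det (Mmat rho).
have d_neq0 : d != 0.
  by rewrite /d det_Mmat; apply/prodf_neq0 => C _; apply: mckay_factor_neq0.
pose wt c : algC := #|irr_class (c : Iirr G)|%:R / #|G|%:R.
(* Up to the factor [d], this is [wt] divided entrywise by [F]; multiplying by [d] clears the
   denominators. *)
pose u : 'cV[{poly algC}]_(Nirr G) :=
  \col_c ((wt c)%:P * \prod_(c' | c' != c) F c').
(* Orthogonality of ['chi_i] with the trivial character. *)
have wtE : character_table G *m (\col_c wt c) = delta_mx 0 0.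
  apply/colP=> i; rewrite !mxE.
  have := cfdot_irr i 0; rewrite cfdotE irr0.
  rewrite sum_by_classes => [|x y Gx Gy]; last by rewrite !cfunJ.
  rewrite reindex_irr_class mulr_sumr => E.
  rewrite andbT -E; apply: eq_bigr => c _; rewrite !mxE /wt cfun1E.
  have /repr_classesP[-> _] := irr_classP c.
  by rewrite conjC1 /=; ring.
have eqd : (Mmat rho)^T *m (XP *m u) = d *: delta_mx 0 0.
  have -> : delta_mx 0 0 = map_mx polyC (delta_mx 0 0 : 'cV[algC]_(Nirr G)).
    by rewrite map_delta_mx.
  rewrite mulmxA Mmat_character_table -mulmxA -wtE map_mxM scalemxAr.
  congr (_ *m _); apply/colP=> c; rewrite mul_diag_mx !mxE mulrCA mulrC.
  by rewrite /d det_Mmat reindex_irr_class [in RHS](bigD1 c).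
(* Multiply [eqd] by the adjugate and cancel [d]. *)
have adjE : \adj (Mmat rho)^T 0 0 = (XP *m u) 0 0.
  have /(congr1 (mulmx (\adj (Mmat rho)^T))) := eqd.
  rewrite mulmxA mul_adj_mx det_tr -/d mul_scalar_mx -scalemxAr => /colP/(_ 0).
  rewrite mxE [RHS]mxE => /(mulfI d_neq0) ->.
  by rewrite -colE [RHS]mxE.
(* Expansion along column 0, whose only nonzero entry is the leading 1. *)
have -> : \det (M0mat rho) = \adj (Mmat rho)^T 0 0.
  rewrite [RHS]mxE cofactor_tr (expand_det_col _ 0) (bigD1 0) //= big1 ?addr0 => [|i].
    rewrite mxE eqxx mul1r /cofactor; congr (_ * \det _).
    by apply/matrixP=> i j; rewrite !mxE.
  by rewrite mxE /= -val_eqE /= => /negPf->; rewrite mul0r.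
rewrite adjE mxE rmorph_sum /= mulrA [RHS]mulrC.
rewrite (sum_by_classes (F := fun g => ((mckay_factor rho g)%:F)^-1)); last first.
  by move=> g h Gg Gh; rewrite mckay_factorJ.
rewrite reindex_irr_class mulr_suml; apply: eq_bigr => c _.
rewrite !mxE -/(F c) irr0 cfun1E; have /repr_classesP[-> _] := irr_classP c.
rewrite polyC1 mul1r /d det_Mmat reindex_irr_class [in RHS](bigD1 c) //= -/(F c).
have Fc0 : (F c)%:F != 0 by rewrite tofrac_eq0 mckay_factor_neq0.
have G0 : (#|G|%:R : {fraction {poly algC}}) != 0.
  by rewrite -(rmorph_nat (@tofrac {poly algC})) tofrac_eq0 -polyC_natr polyC_eq0 neq0CG.
have wtE' : (wt c)%:P%:F = #|irr_class c|%:R / #|G|%:R.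
  apply: (canRL (mulfK G0)).
  rewrite -[#|G|%:R](rmorph_nat (@tofrac _)) -rmorphM -polyC_natr -polyCM /wt.
  by rewrite divfK ?neq0CG // polyC_natr rmorph_nat.
rewrite -/(F c); set P := \prod_(i < _ | _) _.
rewrite (tofracM _ P) (tofracM (F c)) wtE'.
move: Fc0 {wtE'}; generalize (F c)%:F; generalize P%:F => P' f.
exact: div_mul_swap.
Qed.

End Determinants.

(** * Matrices over the Eisenstein integers *)

Definition eis := (Z * Z)%type.
Definition triple (T : Type) := (T * T * T)%type.
Definition mat3 := triple (triple eis).
(* A pair [(a, b) : eis] stands for [a + b * omega], and [(j, A) : code], with [j < 3], for the
   matrix [eps ^+ j *: (latQ *m A *m invmx latQ)]; see [cval]. *)
Definition code := (nat * mat3)%type.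

Definition eadd (x y : eis) : eis := (Z.add x.1 y.1, Z.add x.2 y.2).
Definition emul (x y : eis) : eis :=
  let: (a, b) := x in let: (c, d) := y in let bd := Z.mul b d in
  (Z.sub (Z.mul a c) bd, Z.sub (Z.add (Z.mul a d) (Z.mul b c)) bd).

Definition omega_eis : eis := (Z0, Zpos xH).
Definition omega2_eis : eis := (Zneg xH, Zneg xH).

Definition tmap (T U : Type) (f : T -> U) (u : triple T) : triple U :=
  let: (x, y, z) := u in (f x, f y, f z).
Definition tnth3 (T : Type) (u : triple T) (i : nat) : T :=
  match i with 0 => u.1.1 | 1 => u.1.2 | _ => u.2 end.

Definition dot (u v : triple eis) : eis :=
  let: (a, b, c) := u in let: (x, y, z) := v in
  eadd (emul a x) (eadd (emul b y) (emul c z)).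
Definition mmul (A B : mat3) : mat3 :=
  let: ((a, b, c), (d, e, f), (g, h, i)) := B in
  tmap (fun r => (dot r (a, d, g), dot r (b, e, h), dot r (c, f, i))) A.
Definition mscale (k : eis) : mat3 -> mat3 := tmap (tmap (emul k)).
Definition mtr (A : mat3) : eis := eadd A.1.1.1.1 (eadd A.1.2.1.2 A.2.2).

(** The carry [eps ^+ 3 = omega ^+ 2] is absorbed by the matrix, which keeps the exponent below
    3. *)
Definition cmul (x y : code) : code :=
  let: (j, A) := x in let: (k, B) := y in
  let n := (j + k)%N in let C := mmul A B in
  if (n < 3)%N then (n, C) else ((n - 3)%N, mscale omega2_eis C).
Definition ctr (x : code) : nat * eis := (x.1, mtr x.2).

Local Open Scope Z_scope.
Definition code1 : code := (0%N,
  (((1, 0), (0, 0), (0, 0)), ((0, 0), (1, 0), (0, 0)), ((0, 0), (0, 0), (1, 0)))).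
(** The generators in the basis [latQ]. The denominator of [HV] disappears there, because a sum of
    three coordinates congruent modulo [sqrt(-3)] is divisible by [sqrt(-3)]. *)
Definition cS1 : code := (0%N,
  (((1, 0), (0, 0), (0, 0)), ((1, 1), (0, 1), (0, 0)), ((0, 1), (0, 0), (-1, -1)))).
Definition cT0 : code := (0%N,
  (((1, 0), (1, 2), (0, 0)), ((0, 0), (-1, 0), (1, 0)), ((0, 0), (-1, 0), (0, 0)))).
Definition cV : code := (0%N,
  (((-1, -2), (1, 0), (1, 0)), ((1, 0), (1, 1), (0, 1)), ((1, 0), (0, 1), (1, 1)))).
Definition cU : code := (1%N,
  (((1, 0), (0, 0), (0, 0)), ((0, 0), (1, 0), (0, 0)), ((1, 1), (0, 0), (0, 1)))).
Local Close Scope Z_scope.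

(** * Interpretation of codes as complex matrices *)

Lemma theta_sq : sqrtC (- 3%:R) ^+ 2 = - 3%:R :> algC.
Proof. exact: sqrtCK. Qed.

Lemma theta_omega : sqrtC (- 3%:R) = 1 + 2%:R * omega.
Proof. rewrite /omega mulrCA mulfV ?pnatr_eq0 //; ring. Qed.

Lemma omega_sq : omega ^+ 2 = - 1 - omega.
Proof.
have E : 4%:R * (omega ^+ 2 + omega + 1) = 0.
  transitivity ((1 + 2%:R * omega) ^+ 2 + 3%:R); first by ring.
  by rewrite -theta_omega theta_sq addNr.
have /eqP := E; rewrite mulf_eq0 pnatr_eq0 /= => /eqP E'.
by rewrite -[omega ^+ 2]subr0 -E'; ring.
Qed.

Lemma theta_neq0 : sqrtC (- 3%:R) != 0 :> algC.
Proof. by rewrite sqrtC_eq0 oppr_eq0 pnatr_eq0. Qed.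

Definition Zval (R : pzRingType) (a : Z) : R := (int_of_Z a)%:~R.
Arguments Zval {R} a%_Z_scope.

Section Zval.
Variable R : pzRingType.

Lemma ZvalD a b : Zval (Z.add a b) = Zval a + Zval b :> R.
Proof. by rewrite /Zval -[Z.add a b]/(a + b)%R rmorphD rmorphD. Qed.

Lemma ZvalB a b : Zval (Z.sub a b) = Zval a - Zval b :> R.
Proof. by rewrite /Zval -[Z.sub a b]/(a - b)%R rmorphB rmorphB. Qed.

Lemma ZvalM a b : Zval (Z.mul a b) = Zval a * Zval b :> R.
Proof. by rewrite /Zval -[Z.mul a b]/(a * b)%R rmorphM rmorphM. Qed.

Lemma ZvalE : (Zval 0 = 0 :> R) * (Zval 1 = 1 :> R) * (Zval 2 = 2%:R :> R)
  * (Zval 3 = 3%:R :> R) * (Zval (-1) = -1 :> R).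
Proof. by []. Qed.

End Zval.

Definition ev (x : eis) : algC := Zval x.1 + Zval x.2 * omega.

Lemma ev_add x y : ev (eadd x y) = ev x + ev y.
Proof. by rewrite /ev /= !ZvalD; ring. Qed.

Lemma ev_mul x y : ev (emul x y) = ev x * ev y.
Proof.
case: x y => a b [c d]; rewrite /ev /= !(ZvalB, ZvalD, ZvalM).
by ring: omega_sq.
Qed.

Definition mval (A : mat3) : 'M[algC]_3 :=
  \matrix_(i < 3, j < 3) ev (tnth3 (tnth3 A i) j).

Lemma ev_dot u v :
  ev (dot u v) = \sum_(k < 3) ev (tnth3 u k) * ev (tnth3 v k).
Proof.
case: u v => [[a b] c] [[x y] z].
by rewrite /dot !ev_add !ev_mul !big_ord_recl big_ord0 addr0.
Qed.

Lemma tnth3_map (T U : Type) (f : T -> U) u i : tnth3 (tmap f u) i = f (tnth3 u i).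
Proof. by case: u => [[a b] c]; case: i => [|[|i]]. Qed.

Lemma mval_mul A B : mval (mmul A B) = mval A *m mval B.
Proof.
case: B => [[[[a b] c] [[d e] f]] [[g h] i]].
apply/matrixP=> p q; rewrite !mxE /mmul tnth3_map.
rewrite [LHS](_ : _ = ev (dot (tnth3 A p) (tmap (fun r => tnth3 r q)
  ((a, b, c), (d, e, f), (g, h, i))))); last by case: q => [[|[|[]]]].
by rewrite ev_dot; apply: eq_bigr => k _; rewrite !mxE tnth3_map.
Qed.

Lemma mval_scale k A : mval (mscale k A) = ev k *: mval A.
Proof. by apply/matrixP=> p q; rewrite !mxE /mscale !tnth3_map ev_mul. Qed.

Lemma mval_tr A : \tr (mval A) = ev (mtr A).
Proof.
by rewrite /mxtrace !big_ord_recl big_ord0 !mxE /mtr !ev_add addr0.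
Qed.

(* The columns are a basis of the lattice of vectors of [Z[omega]^3] whose coordinates are
   congruent modulo [sqrt (-3) = 1 + 2 * omega]. *)
Definition latQ : 'M[algC]_3 :=
  \matrix_(i < 3, j < 3)
    (if (j : nat) == 0%N then 1 else if i == j then 1 + 2%:R * omega else 0).

Lemma latQ_unit : latQ \in unitmx.
Proof.
have : latQ *m (\matrix_(i < 3, j < 3) (if (j : nat) == 0%N then
   (if (i : nat) == 0%N then 1 else - (1 + 2%:R * omega)^-1) else
   if i == j then (1 + 2%:R * omega)^-1 else 0)) = 1%:M.
  have t0 := theta_neq0; rewrite theta_omega in t0.
  apply/matrixP=> i j; rewrite !mxE !big_ord_recl big_ord0 !mxE /=.
  by case: i j => [[|[|[]]] //= ?] [[|[|[]]] //= ?]; rewrite /= -?val_eqE /=; field.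
by case/mulmx1_unit.
Qed.

Section Valuation.
Variable eps : algC.
Hypothesis eps3 : eps ^+ 3 = omega ^+ 2.

Definition cval (x : code) : 'M[algC]_3 :=
  eps ^+ x.1 *: (latQ *m mval x.2 *m invmx latQ).

Lemma cval_mul x y : cval (cmul x y) = cval x *m cval y.
Proof.
case: x y => j A [k B]; rewrite /cval -scalemxAl -scalemxAr /=.
rewrite scalerA -exprD !mulmxA mulmxKV ?latQ_unit // -[_ *m _ *m mval B]mulmxA -mval_mul.
case: ltnP => //= le3; rewrite mval_scale -scalemxAr -scalemxAl scalerA.
congr (_ *: _); rewrite -[in RHS](subnK le3) exprD eps3 omega_sq /ev /=.
by ring.
Qed.

Lemma cval_tr x : \tr (cval x) = eps ^+ x.1 * ev (mtr x.2).
Proof. by rewrite mxtraceZ mxtrace_mulC mulKmx ?latQ_unit // mval_tr. Qed.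

Lemma cval_code1 : cval code1 = 1%:M.
Proof.
rewrite /cval expr0 scale1r (_ : mval _ = 1%:M) ?mulmx1 ?mulmxV ?latQ_unit //.
apply/matrixP=> i j; rewrite !mxE /ev.
by case: i j => [[|[|[]]] //= ?] [[|[|[]]] //= ?]; rewrite /= -?val_eqE /=; ring.
Qed.

Lemma cval_intro (M : 'M[algC]_3) x :
  M *m latQ = eps ^+ x.1 *: (latQ *m mval x.2) -> M = cval x.
Proof. by move=> E; rewrite /cval scalemxAl -E mulmxK ?latQ_unit. Qed.

Ltac entrywise :=
  apply/matrixP=> -[[|[|[|?]]] //= ?] -[[|[|[|?]]] //= ?];
  rewrite !mxE !big_ord_recl !big_ord0 !mxE /= -?val_eqE /= /ev /=.

Lemma cval_cS1 : HS1 = cval cS1.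
Proof. apply: cval_intro; entrywise; ring: omega_sq. Qed.

Lemma cval_cT0 : HT0 = cval cT0.
Proof. apply: cval_intro; entrywise; ring: omega_sq. Qed.

Lemma cval_cU : HU eps = cval cU.
Proof. apply: cval_intro; entrywise; ring: omega_sq. Qed.

Lemma cval_cV : HV = cval cV.
Proof.
(* Moving [1 / sqrt(-3)] to the other side leaves polynomial identities in [omega]. *)
apply: cval_intro; rewrite -scalemxAl; apply: (canLR (scalerK theta_neq0)).
by rewrite theta_omega; entrywise; ring: omega_sq.
Qed.

Lemma eps_prim : 9.-primitive_root eps.
Proof.
have w3 : omega ^+ 3 = 1 by ring: omega_sq.
have e9 : eps ^+ 9 = 1 by rewrite (exprM eps 3 3) eps3 exprAC w3 expr1n.
have e3 : eps ^+ 3 != 1.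
  apply/eqP=> e3; have := theta_neq0; rewrite theta_omega.
  have: omega = 1 by rewrite -[LHS]mulr1 -[X in _ * X]e3 eps3 -exprS w3.
  move=> w1; have := omega_sq; rewrite w1 => /eqP; rewrite -subr_eq0.
  by rewrite (_ : _ - _ = 3%:R) ?pnatr_eq0 //; ring.
have [m prim_m] := prim_order_exists (isT : 0 < 9)%N e9.
rewrite dvdn_divisors // !inE => /or3P[] /eqP m_eq; rewrite m_eq in prim_m => //.
  by have := prim_expr_order prim_m; rewrite expr1 => e1; rewrite e1 expr1n eqxx in e3.
by rewrite (prim_expr_order prim_m) eqxx in e3.
Qed.

(** The minimal polynomial of [eps] is the ninth cyclotomic polynomial, of degree 6. *)
Lemma eps_free (p : {poly rat}) : (size p <= 6)%N -> (map_poly ratr p).[eps] = 0 -> p = 0.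
Proof.
move=> sp p0; have [m [mE mon_m m_dvd]] := minCpolyP eps.
have : root (map_poly ratr p) eps by apply/rootP.
rewrite m_dvd => mp; apply/eqP; apply: contraTT mp => pn0.
apply/negP=> /(dvdp_leq pn0); rewrite -(size_map_poly (@ratr algC)) -mE.
rewrite (minCpoly_cyclotomic eps_prim) size_cyclotomic.
by move=> /leq_trans/(_ sp).
Qed.

End Valuation.

(** * Uniqueness of the code of a nonzero matrix *)

Section Injectivity.
Variable eps : algC.
Hypothesis eps3 : eps ^+ 3 = omega ^+ 2.

(** Expansion of [eps ^+ j * ev a] in powers of [eps], obtained from [omega = - 1 - eps ^+ 3]. *)
Definition eis_poly (j : nat) (a : eis) : {poly rat} :=
  ((int_of_Z a.1)%:~R - (int_of_Z a.2)%:~R) *: 'X^j - (int_of_Z a.2)%:~R *: 'X^(j + 3).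

Lemma eis_poly_horner j a : (map_poly ratr (eis_poly j a)).[eps] = eps ^+ j * ev a.
Proof.
have E : omega = - 1 - eps ^+ 3 by rewrite eps3 omega_sq; ring.
rewrite /eis_poly !(rmorphB, linearZ) /= !map_polyZ !map_polyXn /=.
rewrite !hornerE rmorphB !rmorph_int exprD /ev /Zval E.
by move: (int_of_Z a.1)%:~R (int_of_Z a.2)%:~R => u v; ring.
Qed.

Lemma coef_eis_poly i j a : (eis_poly j a)`_i =
  ((int_of_Z a.1)%:~R - (int_of_Z a.2)%:~R) * (i == j)%:R
    - (int_of_Z a.2)%:~R * (i == j + 3)%N%:R.
Proof. by rewrite coefB !coefZ !coefXn. Qed.

Lemma size_eis_poly j a : (j < 3)%N -> (size (eis_poly j a) <= 6)%N.
Proof.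
move=> lj; apply: leq_trans (size_polyD _ _) _; rewrite size_polyN geq_max.
by apply/andP; split; apply: leq_trans (size_scale_leq _ _) _; rewrite size_polyXn; lia.
Qed.

Lemma eis_poly_eq0 j a : eis_poly j a = 0 -> a = (Z0, Z0).
Proof.
move=> p0; have C i := congr1 (fun p : {poly rat} => p`_i) p0.
have := C (j + 3)%N; have := C j; rewrite !coef_eis_poly !coef0 !eqxx.
have -> : (j == j + 3)%N = false by lia.
have -> : (j + 3 == j)%N = false by lia.
rewrite !mulr0 !mulr1 subr0 sub0r => /eqP; rewrite -rmorphB intr_eq0 => + /eqP.
rewrite oppr_eq0 intr_eq0 => + /eqP a2; rewrite a2 subr0 => /eqP a1.
by apply: injective_projections; apply: (can_inj int_of_ZK).
Qed.

(** By [eps_free] the two polynomials coincide. The second alternative is there because zero is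
    represented with every exponent. *)
Lemma eps_ev_inj j k a b : (j < 3)%N -> (k < 3)%N ->
  eps ^+ j * ev a = eps ^+ k * ev b ->
  (j == k) && (a == b) || (a == (Z0, Z0)) && (b == (Z0, Z0)).
Proof.
move=> lj lk E.
have /eqP : eis_poly j a - eis_poly k b = 0.
  apply: (eps_free eps3); last by rewrite rmorphB hornerD hornerN !eis_poly_horner E subrr.
  by apply: leq_trans (size_polyD _ _) _; rewrite size_polyN geq_max !size_eis_poly.
rewrite subr_eq0 => /eqP P; have C i := congr1 (fun p : {poly rat} => p`_i) P.
have [jk | neq] := eqVneq j k.
  rewrite {}jk in C; have := C (k + 3)%N; have := C k; rewrite !coef_eis_poly !eqxx.
  have -> : (k == k + 3)%N = false by lia.
  have -> : (k + 3 == k)%N = false by lia.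
  rewrite !mulr0 !mulr1 !subr0 !sub0r => + /oppr_inj/eqP.
  rewrite eqr_int => + /eqP a2; rewrite a2 => /addIr/eqP; rewrite eqr_int => /eqP a1.
  apply/orP; left; apply/eqP.
  by apply: injective_projections; apply: (can_inj int_of_ZK).
(* For [j != k] the supports [{j, j + 3}] and [{k, k + 3}] are disjoint. *)
have Q : eis_poly j a = 0.
  apply/polyP=> i; rewrite coef0; have := C i; have := C j; have := C (j + 3)%N.
  rewrite !coef_eis_poly !eqxx.
  have -> : (j == j + 3)%N = false by lia.
  have -> : (j + 3 == j)%N = false by lia.
  have -> : (j + 3 == k)%N = false by lia.
  have -> : (j == k)%N = false by lia.
  have -> : (j == k + 3)%N = false by lia.
  have -> : (j + 3 == k + 3)%N = false by lia.
  rewrite !mulr0 !mulr1 !subr0 !sub0r => /eqP; rewrite oppr_eq0 => /eqP -> /eqP.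
  by rewrite subr0 => /eqP -> _; rewrite !mul0r subr0.
by rewrite (eis_poly_eq0 Q) (eis_poly_eq0 (etrans (esym P) Q)) eqxx orbT.
Qed.

Definition czero : mat3 :=
  let z := ((Z0, Z0), (Z0, Z0), (Z0, Z0)) in (z, z, z).

Lemma tnth3_ext (T : Type) (u v : triple T) :
  (forall i : 'I_3, tnth3 u i = tnth3 v i) -> u = v.
Proof.
case: u v => [[a b] c] [[a' b'] c'] E.
by have := E 0; have := E 1; have := E 2%:R; rewrite /= => -> -> ->.
Qed.

Lemma cval_inj x y : (x.1 < 3)%N -> (y.1 < 3)%N -> x.2 != czero ->
  cval eps x = cval eps y -> x = y.
Proof.
case: x y => j A [k B] /= lj lk nzA.
have conjK (M : 'M_3) : invmx latQ *m (latQ *m M *m invmx latQ) *m latQ = M.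
  by rewrite -!mulmxA mulVmx ?latQ_unit // mulmx1 mulKmx ?latQ_unit.
have entryE i (M : mat3) p q : (eps ^+ i *: mval M) p q = eps ^+ i * ev (tnth3 (tnth3 M p) q).
  by rewrite !mxE.
rewrite /cval /= => /(congr1 (fun M => invmx latQ *m M *m latQ)).
rewrite -!scalemxAr -!scalemxAl !conjK => /matrixP E.
have {}E p q := eps_ev_inj lj lk
  (etrans (esym (entryE j A p q)) (etrans (E p q) (entryE k B p q))).
(* Different exponents would force every entry of [A] to vanish. *)
have [jk | neq] := boolP (j == k); last first.
  case/eqP: nzA; apply: tnth3_ext => p; apply: tnth3_ext => q.
  have := E p q; rewrite (negPf neq) /= => /andP[/eqP-> _].
  by case: p q => [[|[|[|?]]] //= ?] [[|[|[|?]]] //= ?].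
congr (_, _); first exact/eqP.
apply: tnth3_ext => p; apply: tnth3_ext => q.
by have /orP[/andP[_ /eqP] | /andP[/eqP-> /eqP->]] := E p q.
Qed.

End Injectivity.

(** * Enumeration of the conjugacy classes *)

Local Open Scope Z_scope.
Definition cS1V : code := (0%N,
  (((1, 0), (0, 0), (0, 0)), ((0, 1), (-1, -1), (0, 0)), ((1, 1), (0, 0), (0, 1)))).
Definition cT0V : code := (0%N,
  (((1, 0), (0, 0), (1, 2)), ((0, 0), (0, 0), (-1, 0)), ((0, 0), (1, 0), (-1, 0)))).
Definition cVV : code := (0%N,
  (((1, 2), (-1, 0), (-1, 0)), ((-1, 0), (0, -1), (-1, -1)), ((-1, 0), (-1, -1), (0, -1)))).
(** The exponent 2 and the factor [omega] come from [eps^-1 = eps ^+ 2 * omega]. *)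
Definition cUV : code := (2%N,
  (((0, 1), (0, 0), (0, 0)), ((0, 0), (0, 1), (0, 0)), ((-1, -1), (0, 0), (1, 0)))).
Local Close Scope Z_scope.

(* Every letter is a pair made of a generator and its inverse. *)
Definition word := seq (code * code).
Definition gS : code * code := (cS1, cS1V).
Definition gT0 : code * code := (cT0, cT0V).
Definition gV : code * code := (cV, cVV).
Definition gU : code * code := (cU, cUV).
Definition cgens : word := [:: gS; gT0; gV; gU].

Definition weval (w : word) : code := foldr (fun p x => cmul p.1 x) code1 w.
Definition wevalV (w : word) : code := foldr (fun p x => cmul x p.2) code1 w.

Definition conjs (x : code) : seq code := [seq cmul p.1 (cmul x p.2) | p <- cgens].

(* Breadth-first closure of [seen] under conjugation by the generators, [todo] being the
   queue of elements whose conjugates have not been computed yet. *)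
Fixpoint grow (n : nat) (todo seen : seq code) : seq code :=
  if n is n'.+1 then
    if todo is x :: todo' then
      let new := [seq y <- undup (conjs x) | y \notin seen] in
      grow n' (todo' ++ new) (seen ++ new)
    else seen
  else seen.

Definition wclass (fuel : nat) (w : word) : seq code :=
  let r := weval w in grow fuel [:: r] [:: r].

(* [gU] cubed is the scalar matrix [omega ^+ 2], hence the first seven words
   come with their multiples by the centre. *)
Definition cwords : seq word :=
  flatten [seq [:: w; nseq 3 gU ++ w; nseq 6 gU ++ w] |
    w <- [:: [::]; [:: gV]; [:: gV; gV]; [:: gU]; [:: gU; gU];
             [:: gU; gV; gV]; [:: gU; gU; gV]]]
  ++ [:: [:: gS]; [:: gU; gT0]; [:: gU; gU; gT0]].

(* [L] is closed under left multiplication by the generators, hence exhausts the group, and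
   each list of the table is a full conjugacy class, no two being equal. *)
Definition class_table_ok (cl : seq (word * seq code)) : bool :=
  let L := flatten [seq p.2 | p <- cl] in
  [&& uniq L, code1 \in L,
      all (fun x => (x.1 < 3)%N && (x.2 != czero)) L,
      all (fun x => all (fun p => cmul p.1 x \in L) cgens) L,
      all (fun p => weval p.1 \in p.2) cl,
      all (fun p => all (fun x => all (mem p.2) (conjs x)) p.2) cl &
      pairwise (fun p q => weval q.1 \notin p.2) cl].

(** The largest class has 72 elements, so a fuel of 100 empties every queue; the test itself checks
    that each list is closed. *)
Lemma class_tableP : class_table_ok [seq (w, wclass 100 w) | w <- cwords].
Proof. by vm_compute. Qed.

Lemma cgensVP : all (fun p => cmul p.1 p.2 == code1) cgens.
Proof. by vm_compute. Qed.

Lemma wevalVP : all (fun w => cmul (weval w) (wevalV w) == code1) cwords.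
Proof. by vm_compute. Qed.

Lemma cwordsP : all (all (mem cgens)) cwords.
Proof. by vm_compute. Qed.

Lemma class_table_facts (cl : word -> seq code) (s : seq word)
    (L := flatten [seq cl w | w <- s]) :
  class_table_ok [seq (w, cl w) | w <- s] ->
  [/\ uniq L, code1 \in L & {in L, forall x, (x.1 < 3)%N && (x.2 != czero)}] /\
  [/\ {in L, forall x, {in cgens, forall p, cmul p.1 x \in L}},
      {in s, forall w, weval w \in cl w},
      {in s, forall w, {in cl w, forall x, {subset conjs x <= cl w}}} &
      pairwise (fun v w => weval w \notin cl v) s].
Proof.
rewrite /class_table_ok -map_comp -/L => /and5P[uL L1 wfL cL /and3P[ew cw pw]].
split; first by split=> // x; apply: (allP wfL).
split=> [x Lx p gp|w sw|w sw x xw y yx|].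
- by have /allP := allP cL x Lx; apply.
- exact: (allP ew _ (map_f (fun v => (v, cl v)) sw)).
- have := allP cw _ (map_f (fun v => (v, cl v)) sw).
  by move=> /allP/(_ x xw)/allP/(_ y yx).
- by move: pw; rewrite pairwise_map.
Qed.

(** Whatever the fuel, the search only ever adds conjugates of elements from the queue. *)
Lemma grow_ind (P : code -> Prop) n todo seen :
  (forall x, P x -> forall y, y \in conjs x -> P y) ->
  {in todo, forall x, P x} -> {in seen, forall x, P x} ->
  {in grow n todo seen, forall x, P x}.
Proof.
move=> PJ; elim: n todo seen => [|n IHn] //= [|x todo] //= seen Ptodo Pseen.
have Pnew : {in [seq y <- undup (conjs x) | y \notin seen], forall y, P y}.
  move=> y; rewrite mem_filter mem_undup => /andP[_]; apply: PJ.
  by apply: Ptodo; rewrite mem_head.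
apply: IHn => y; rewrite mem_cat => /orP[]; [|exact: Pnew|exact: Pseen|exact: Pnew].
by move=> yt; apply: Ptodo; rewrite inE yt orbT.
Qed.

(** * Transport of the table of codes to the abstract group *)

Section Enumeration.
Variables (gT : finGroupType) (G : {group gT}).
Variables (rho : mx_representation algC G 3) (eps : algC).
Hypothesis eps3 : eps ^+ 3 = omega ^+ 2.
Hypothesis rho_inj : {in G &, injective rho}.
Hypothesis rho_gen : forall A : 'M[algC]_3,
  (exists2 g, g \in G & rho g = A) <-> gen_by [:: HS1; HT0; HV; HU eps] A.

(* [fuel] and [ws] are abstract to prevent unification from evaluating the table. *)
Variables (fuel : nat) (ws : seq word).
Hypothesis ws_gen : all (all (mem cgens)) ws.
Hypothesis ws_inv : all (fun w => cmul (weval w) (wevalV w) == code1) ws.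
Hypothesis ws_table : class_table_ok [seq (w, wclass fuel w) | w <- ws].

Let L := flatten [seq wclass fuel w | w <- ws].

(** The choice is unique since [rho] is injective. Codes outside the image get the default [1],
    hence the side conditions [in_G]. *)
Definition of_code (x : code) : gT :=
  odflt 1%g [pick g in G | rho g == cval eps x].

Definition in_G (x : code) := exists2 g, g \in G & rho g = cval eps x.

Lemma of_codeP x : in_G x -> of_code x \in G /\ rho (of_code x) = cval eps x.
Proof.
rewrite /of_code => -[g Gg gx]; case: pickP => [h /andP[Gh /eqP hx] //|/(_ g)].
by rewrite Gg gx eqxx.
Qed.

Lemma of_code_eq x g : g \in G -> rho g = cval eps x -> in_G x /\ of_code x = g.
Proof.
move=> Gg gx; have Ix : in_G x by exists g.
by split=> //; have [Gx rx] := of_codeP Ix; apply: rho_inj => //; rewrite rx.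
Qed.

Lemma of_codeM x y :
  in_G x -> in_G y -> in_G (cmul x y) /\ of_code (cmul x y) = (of_code x * of_code y)%g.
Proof.
move=> /of_codeP[Gx rx] /of_codeP[Gy ry]; apply: of_code_eq; first exact: groupM.
by rewrite repr_mxM // rx ry cval_mul.
Qed.

Lemma of_code1 : in_G code1 /\ of_code code1 = 1%g.
Proof. by apply: of_code_eq => //; rewrite repr_mx1 cval_code1. Qed.

Lemma of_codeV x y : in_G x -> cmul x y = code1 -> in_G y /\ of_code y = (of_code x)^-1%g.
Proof.
move=> /of_codeP[Gx rx] xy; apply: of_code_eq; rewrite ?groupV //.
rewrite -[LHS]mulmx1 -(cval_code1 eps) -xy cval_mul // -rx mulmxA -repr_mxM ?groupV //.
by rewrite mulVg repr_mx1 mul1mx.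
Qed.

Lemma cgens_cval p : p \in cgens -> cval eps p.1 \in [:: HS1; HT0; HV; HU eps].
Proof.
by rewrite !inE => /or4P[] /eqP->; rewrite /= -?(cval_cS1 eps) -?(cval_cT0 eps)
  -?(cval_cU eps) -?(cval_cV eps) eqxx ?orbT.
Qed.

Lemma cval_cgens M : M \in [:: HS1; HT0; HV; HU eps] -> exists2 p, p \in cgens & M = cval eps p.1.
Proof.
rewrite !inE => /or4P[] /eqP->.
- by exists gS; rewrite ?mem_head // (cval_cS1 eps).
- by exists gT0; rewrite ?inE ?eqxx ?orbT // (cval_cT0 eps).
- by exists gV; rewrite ?inE ?eqxx ?orbT // (cval_cV eps).
- by exists gU; rewrite ?inE ?eqxx ?orbT // (cval_cU eps).
Qed.

Lemma in_G_gen p : p \in cgens ->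
  [/\ in_G p.1, in_G p.2 & of_code p.2 = (of_code p.1)^-1%g].
Proof.
move=> gp; have I1 : in_G p.1.
  by apply/rho_gen; rewrite -[cval _ _]mulmx1; apply: gen_byM (gen_by1 _); apply: cgens_cval.
have /eqP/(of_codeV I1)[] := allP cgensVP p gp; by split.
Qed.

Lemma of_code_conj p x : p \in cgens -> in_G x ->
  in_G (cmul p.1 (cmul x p.2)) /\
  of_code (cmul p.1 (cmul x p.2)) = (of_code x ^ (of_code p.1)^-1)%g.
Proof.
move=> /in_G_gen[I1 I2 E] Ix; have [I3 E3] := of_codeM Ix I2.
have [I4 E4] := of_codeM I1 I3; split=> //.
by rewrite E4 E3 E conjgE invgK mulgA.
Qed.

Lemma in_G_word w : all (mem cgens) w -> in_G (weval w).
Proof.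
elim: w => [|p w IHw] /=; first by case: of_code1.
by case/andP=> /in_G_gen[I1 _ _] /IHw Iw; case: (of_codeM I1 Iw).
Qed.

(** Soundness of the search; [class_of_code] adds its completeness. *)
Lemma in_class w x : w \in ws -> x \in wclass fuel w ->
  in_G x /\ of_code x \in (of_code (weval w) ^: G)%g.
Proof.
move=> /(allP ws_gen)/in_G_word Iw; move: x; apply: grow_ind => [x [Ix xw] y|x|x].
- case/mapP=> p gp ->; have [Iy Ey] := of_code_conj gp Ix; split=> //.
  have [/of_codeP[Gp _] _ _] := in_G_gen gp.
  by rewrite Ey (class_transl (y := of_code x)) // memJ_class ?groupV.
- by rewrite inE => /eqP->; split=> //; apply: class_refl.
- by rewrite inE => /eqP->; split=> //; apply: class_refl.
Qed.

Let facts := class_table_facts ws_table.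

Lemma in_G_L x : x \in L -> in_G x.
Proof. by case/flatten_mapP=> w cw /(in_class cw)[]. Qed.

Lemma of_code_inj : {in L &, injective of_code}.
Proof.
have [[_ _ wfL] _] := facts; move=> x y Lx Ly E.
have [_ rx] := of_codeP (in_G_L Lx); have [_ ry] := of_codeP (in_G_L Ly).
have /andP[x3 xn0] := wfL x Lx; have /andP[y3 _] := wfL y Ly.
by apply: (cval_inj eps3) => //; rewrite -rx -ry E.
Qed.

(** Induction on [gen_by], pulled back to [G] along the injective [rho]. *)
Lemma gen_ind (P : gT -> Prop) : P 1%g ->
  (forall p g, p \in cgens -> g \in G -> P g -> P (of_code p.1 * g)%g) ->
  {in G, forall g, P g}.
Proof.
move=> P1 PM g Gg; have : gen_by [:: HS1; HT0; HV; HU eps] (rho g) by apply/rho_gen; exists g.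
move: {-1}(rho g) (erefl (rho g)) => M E genM.
elim: genM g Gg E => {M} [|M N gM genN IHN] g Gg E.
  by rewrite (_ : g = 1%g) //; apply: rho_inj; rewrite // E repr_mx1.
have [h Gh hN] : exists2 h, h \in G & rho h = N by apply/rho_gen.
have [p gp Mp] := cval_cgens gM; have [/of_codeP[Gp rp] _ _] := in_G_gen gp.
rewrite (_ : g = of_code p.1 * h)%g; first by apply: PM => //; apply: IHN.
by apply: rho_inj; rewrite ?groupM // repr_mxM // E hN rp Mp.
Qed.

Lemma of_code_surj g : g \in G -> exists2 x, x \in L & of_code x = g.
Proof.
have [[_ L1 _] [LM _ _ _]] := facts.
move: g; apply: gen_ind => [|p _ gp _ [x Lx <-]].
  by exists code1 => //; case: of_code1.
have [I1 _ _] := in_G_gen gp; have [_ E] := of_codeM I1 (in_G_L Lx).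
by exists (cmul p.1 x) => //; apply: LM.
Qed.

Lemma wclass_sub w : w \in ws -> {subset wclass fuel w <= L}.
Proof. by move=> cw x xw; apply/flatten_mapP; exists w. Qed.

Lemma class_of_code w : w \in ws ->
  (of_code (weval w) ^: G)%g =i [seq of_code x | x <- wclass fuel w].
Proof.
have [_ [_ ew cJ _]] := facts; move=> cw g; apply/idP/mapP => [|[x xw ->]]; last first.
  by case: (in_class cw xw).
(* The induction runs on the inverse of the conjugating element: a new letter on its left becomes
   one more conjugation of the form listed by [conjs]. *)
case/imsetP=> h Gh ->; rewrite -[h]invgK; move: (groupVr Gh); move: h^-1%g => {g Gh}h.
move: h; apply: gen_ind => [|p h gp Gh [x xw E]].
  by exists (weval w); rewrite ?ew // invg1 conjg1.
have [_ Ey] := of_code_conj gp (in_G_L (wclass_sub cw xw)).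
exists (cmul p.1 (cmul x p.2)); last by rewrite Ey -E -conjgM -invMg.
by apply: (cJ w cw x xw); apply: (map_f (fun r => cmul r.1 (cmul x r.2))) gp.
Qed.

Lemma perm_enum_G : perm_eq (enum G) [seq of_code x | x <- L].
Proof.
have [[uL _ _] _] := facts.
apply: uniq_perm; rewrite ?enum_uniq ?map_inj_in_uniq //; first exact: of_code_inj.
move=> g; rewrite mem_enum; apply/idP/mapP => [/of_code_surj[x Lx <-]|[x Lx ->]].
  by exists x.
by case: (of_codeP (in_G_L Lx)).
Qed.

Lemma perm_enum_classes :
  perm_eq (enum (classes G)) [seq (of_code (weval w) ^: G)%g | w <- ws].
Proof.
have [[uL _ _] [_ ew _ pw]] := facts.
apply: uniq_perm; rewrite ?enum_uniq //.
  rewrite uniq_pairwise pairwise_map.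
  apply: (sub_in_pairwise (P := mem ws) _ (allss _) pw) => v w cv cw.
  (* Equal classes would put the code [weval w] in the list of [v], by injectivity of [of_code] on
     [L]. *)
  apply: contraNneq => E; have : of_code (weval w) \in [seq of_code x | x <- wclass fuel v].
    by rewrite -class_of_code // E class_refl.
  case/mapP=> x xv /(of_code_inj (wclass_sub cw (ew w cw)) (wclass_sub cv xv)) ->.
  exact: xv.
move=> C; rewrite mem_enum; apply/imsetP/mapP => [[g Gg ->]|[w cw ->]]; last first.
  exists (of_code (weval w)) => //.
  by case: (of_codeP (in_G_word (allP ws_gen w cw))).
have [x /flatten_mapP[w cw xw] <-] := of_code_surj Gg.
by exists w => //; apply/class_eqP; case: (in_class cw xw).
Qed.

Lemma prod_classes (R : comNzRingType) (F : gT -> R) :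
  {in G &, forall g h, F (g ^ h)%g = F g} ->
  \prod_(C in classes G) F (repr C) = \prod_(w <- ws) F (of_code (weval w)).
Proof.
move=> FJ; rewrite -big_enum (perm_big _ perm_enum_classes) big_map.
apply: eq_big_seq => w cw; have [Gw _] := of_codeP (in_G_word (allP ws_gen w cw)).
by have [h Gh ->] := repr_class G (of_code (weval w)); apply: FJ.
Qed.

Lemma sum_group (R : nzRingType) (F : gT -> R) :
  {in G &, forall g h, F (g ^ h)%g = F g} ->
  \sum_(g in G) F g =
  \sum_(w <- ws) (size (wclass fuel w))%:R * F (of_code (weval w)).
Proof.
move=> FJ; rewrite -big_enum (perm_big _ perm_enum_G) big_map big_flatten big_map.
apply: eq_big_seq => w cw; have [Gw _] := of_codeP (in_G_word (allP ws_gen w cw)).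
rewrite mulr_natl -iter_addr_0 -[size _]count_predT -big_const_seq.
by apply: eq_big_seq => x /(in_class cw)[_ /imsetP[h Gh ->]]; apply: FJ.
Qed.

Lemma chi_of_code w : w \in ws ->
  cfRepr rho (of_code (weval w)) = eps ^+ (ctr (weval w)).1 * ev (ctr (weval w)).2 /\
  cfRepr rho (of_code (weval w))^-1%g = eps ^+ (ctr (wevalV w)).1 * ev (ctr (wevalV w)).2.
Proof.
move=> cw; have Iw := in_G_word (allP ws_gen w cw).
have [/of_codeP[Gv rv] <-] := of_codeV Iw (eqP (allP ws_inv w cw)).
have [Gw rw] := of_codeP Iw.
by rewrite !cfunE Gw Gv rw rv !cval_tr.
Qed.

End Enumeration.

(** * Rational functions attached to the classes *)

Section FieldIdentities.
Variables (K : fieldType) (t w : K).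
Hypothesis w_sq : w ^+ 2 = - 1 - w.

Definition char3 (a b : K) : K := 1 - t ^+ 3 - a * t + b * t ^+ 2.

(* The product of [char3] over the orbit of [(a, b)] under [a |-> w * a, b |-> w^-1 * b];
   recall that [w ^+ 2 = - 1 - w]. *)
Definition norm3 (a b : K) : K :=
  1 - (a ^+ 3 - 3%:R * (a * b) + 3%:R) * t ^+ 3
    + (b ^+ 3 - 3%:R * (a * b) + 3%:R) * t ^+ 6 - t ^+ 9.

(** Multiplying an element by [w] replaces [t] by [w * t] in [char3], so the product only involves
    powers of [t ^+ 3]. *)
Lemma char3_prod a b :
  char3 a b * char3 ((- 1 - w) * a) (w * b) * char3 (w * a) ((- 1 - w) * b) = norm3 a b.
Proof. by rewrite /char3 /norm3; ring: w_sq. Qed.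

Lemma char3_sum a b : norm3 a b != 0 ->
  (char3 a b)^-1 + (char3 ((- 1 - w) * a) (w * b))^-1
    + (char3 (w * a) ((- 1 - w) * b))^-1 =
  3%:R * (1 + (a * b - 2%:R) * t ^+ 3 + t ^+ 6) / norm3 a b.
Proof.
move=> N0; have : char3 a b * char3 ((- 1 - w) * a) (w * b) * char3 (w * a) ((- 1 - w) * b) != 0.
  by rewrite char3_prod.
rewrite !mulf_eq0 !negb_or => /andP[/andP[x0 y0] z0].
apply: (canRL (mulfK N0)); rewrite -char3_prod.
transitivity (char3 ((- 1 - w) * a) (w * b) * char3 (w * a) ((- 1 - w) * b)
  + char3 a b * char3 (w * a) ((- 1 - w) * b) + char3 a b * char3 ((- 1 - w) * a) (w * b)).
  move: x0 y0 z0.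
  (* As atoms, the three factors reduce the claim to the addition of three reciprocals. *)
  generalize (char3 a b) (char3 ((- 1 - w) * a) (w * b)) (char3 (w * a) ((- 1 - w) * b)).
  by move=> x y z x0 y0 z0; field; rewrite x0 y0 z0.
by rewrite /char3; ring: w_sq.
Qed.

End FieldIdentities.

(** * The table of class sizes and traces *)

(* The size of a conjugacy class, then the traces of a representative and of its inverse;
   [(j, x)] stands for [eps ^+ j * x]. *)
Definition class_datum := (nat * (nat * eis) * (nat * eis))%type.

Definition datum (n j : nat) (a b : Z) (k : nat) (c d : Z) : class_datum :=
  (n, (j, (a, b)), (k, (c, d))).

Definition ascale (k : eis) (x : nat * eis) := (x.1, emul k x.2).

(** The order [1, omega ^+ 2, omega] is that of the words [w], [gU^3 w], [gU^6 w] in [cwords];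
    inverses are scaled by the inverse scalar. *)
Definition central_orbit (d : class_datum) : seq class_datum :=
  let: (n, x, y) := d in
  [:: (n, x, y); (n, ascale omega2_eis x, ascale omega_eis y);
      (n, ascale omega_eis x, ascale omega2_eis y)].

Definition free_data : seq class_datum :=
  [:: datum 1 0 3 0 0 3 0; datum 54 0 1 0 0 1 0; datum 9 0 (-1) 0 0 (-1) 0;
      datum 12 1 2 1 2 1 2; datum 12 2 1 (-1) 1 (-1) 1;
      datum 36 1 (-1) 0 2 0 (-1); datum 36 2 0 (-1) 1 (-1) 0].

Definition fixed_data : seq class_datum :=
  [:: datum 24 0 0 0 0 0 0; datum 72 1 0 0 2 0 0; datum 72 2 0 0 1 0 0].

(** The sizes add up to [3 * 160 + 168 = 648]. *)
Definition hessian_data : seq class_datum :=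
  flatten [seq central_orbit d | d <- free_data] ++ fixed_data.

Definition wdatum (u : word) : class_datum :=
  (size (wclass 100 u), ctr (weval u), ctr (wevalV u)).

Lemma size_wdatum u : size (wclass 100 u) = (wdatum u).1.1.
(* A plain conversion test would start to evaluate [wclass]. *)
Proof. unfold wdatum, fst; reflexivity. Qed.

Lemma class_data : [seq wdatum u | u <- cwords] = hessian_data.
Proof. by vm_compute. Qed.

Section Evaluation.
Variables (K : fieldType) (t w e : K).
Hypothesis w_sq : w ^+ 2 = - 1 - w.
Hypothesis e3 : e ^+ 3 = w ^+ 2.

Definition trK (x : nat * eis) : K := e ^+ x.1 * (Zval x.2.1 + Zval x.2.2 * w).
Definition charK (d : class_datum) : K := char3 t (trK d.1.2) (trK d.2).
Definition normK (d : class_datum) : K := norm3 t (trK d.1.2) (trK d.2).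

Lemma trK_scale k x : trK (ascale k x) = (Zval k.1 + Zval k.2 * w) * trK x.
Proof.
case: k x => a b [j [c d]]; rewrite /trK /ascale /= !(ZvalB, ZvalD, ZvalM).
by ring: w_sq.
Qed.

Lemma central_orbit_prod d : \prod_(x <- central_orbit d) charK x = normK d.
Proof.
case: d => [[n x] y]; rewrite !big_cons big_nil /charK /normK /= !trK_scale /= !ZvalE.
rewrite -(char3_prod t w_sq) mulr1 mulrA; congr (_ * _ * _);
  rewrite /char3; ring.
Qed.

Lemma central_orbit_sum (d : class_datum) : normK d != 0 ->
  \sum_(x <- central_orbit d) x.1.1%:R / charK x =
  d.1.1%:R * (3%:R * (1 + (trK d.1.2 * trK d.2 - 2%:R) * t ^+ 3 + t ^+ 6) / normK d).
Proof.
case: d => [[n x] y]; rewrite !big_cons big_nil /charK /normK /= !trK_scale /= !ZvalE => N0.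
rewrite -(char3_sum w_sq N0) !mulrDr addr0 addrA.
by congr (_ / _ + _ / _ + _ / _); rewrite /char3; ring.
Qed.

(** The product of [det (1 - t g)] over the orbit of [g] is [det (1 - t^3 g^3)], so the factors
    display the cubes of the eigenvalues. *)
Lemma free_norms (q := t ^+ 3) : [seq normK d | d <- free_data] =
  [:: (1 - q) ^+ 3; (1 - q) * (1 + q ^+ 2); (1 + q) ^+ 2 * (1 - q);
      (1 - (- 1 - w) * q) ^+ 3; (1 - w * q) ^+ 3;
      (1 - (- 1 - w) * q) * (1 + (- 1 - w) * q) ^+ 2; (1 - w * q) * (1 + w * q) ^+ 2].
Proof.
rewrite /q /free_data /datum /= /normK /norm3 /trK /= !ZvalE.
congr [:: _; _; _; _; _; _; _]; ring: w_sq e3.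
Qed.

(** These are the squared absolute values of the traces, needed in the numerators of
    [central_orbit_sum]. *)
Lemma free_products : [seq trK d.1.2 * trK d.2 | d <- free_data] =
  [:: 9%:R; 1; 1; 3%:R; 3%:R; 1; 1].
Proof.
rewrite /free_data /datum /= /trK /= !ZvalE.
congr [:: _; _; _; _; _; _; _]; ring: w_sq e3.
Qed.

End Evaluation.

(** * Product and sum over all classes as rational functions of [q] *)

Section RationalFunctions.
Variables (K : fieldType) (t w e : K).
Hypothesis w_sq : w ^+ 2 = - 1 - w.
Hypothesis e3 : e ^+ 3 = w ^+ 2.
Hypothesis t_neq1 : forall k, t ^+ k.+1 != 1.

Let q := t ^+ 3.

(** Each of these divides [1 - q ^+ 4] or [1 - q ^+ 6], and [t] is not a root of unity. *)
Lemma q_factors :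
  [/\ 1 - q != 0, 1 + q != 0, 1 + q ^+ 2 != 0,
      (1 - (- 1 - w) * q != 0) /\ (1 - w * q != 0) &
      (1 + (- 1 - w) * q != 0) /\ (1 + w * q != 0)].
Proof.
have sub k : 1 - q ^+ k.+1 != 0.
  by rewrite subr_eq0 eq_sym -exprM -[(3 * _)%N]prednK ?muln_gt0 ?t_neq1.
have : 1 - q ^+ 4 = (1 - q) * (1 + q) * (1 + q ^+ 2) by ring.
have : 1 - q ^+ 6 = (1 - q) * (1 + q) * (1 - (- 1 - w) * q) * (1 - w * q)
   * (1 + (- 1 - w) * q) * (1 + w * q) by ring: w_sq.
have := sub 3%N; have := sub 5%N => + + E6 E4; rewrite E6 E4 !mulf_eq0 !negb_or.
by do ![case/andP]=> -> -> -> -> -> -> /andP[_ ->].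
Qed.

Lemma fixed_charK : [seq charK t w e d | d <- fixed_data] = nseq 3 (1 - q).
Proof.
rewrite /fixed_data /datum /= /charK /char3 /trK /= !ZvalE.
congr [:: _; _; _]; rewrite /q; ring.
Qed.

Lemma data_prod : \prod_(d <- hessian_data) charK t w e d =
  (1 - q) ^+ 3 * ((1 - q) * (1 + q ^+ 2)) * ((1 + q) ^+ 2 * (1 - q))
  * (1 + q + q ^+ 2) ^+ 4 * (1 - q + q ^+ 2) ^+ 2 * (1 - q) ^+ 3.
Proof.
rewrite /hessian_data big_cat big_flatten big_map /=.
under eq_bigr do rewrite central_orbit_prod //.
rewrite -(big_map (normK t w e) xpredT id) -(big_map (charK t w e) xpredT id).
rewrite (free_norms t w_sq e3) fixed_charK /= !big_cons !big_nil.
by rewrite -/q; ring: w_sq.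
Qed.

(** A free orbit with classes of size [n] contributes [3 n (1 + (a b - 2) q + q^2)] over its norm.
    Orbits exchanged by [w |-> w ^+ 2] are added in pairs, and 168 counts the elements of the fixed
    classes. *)
Lemma data_sum : \sum_(d <- hessian_data) d.1.1%:R / charK t w e d =
  3%:R * (1 + 7%:R * q + q ^+ 2) / (1 - q) ^+ 3
  + 162%:R * (1 - q + q ^+ 2) / ((1 - q) * (1 + q ^+ 2))
  + 27%:R * (1 - q + q ^+ 2) / ((1 + q) ^+ 2 * (1 - q))
  + 36%:R * (2%:R + 3%:R * q - 3%:R * q ^+ 2 - 2%:R * q ^+ 3) / (1 + q + q ^+ 2) ^+ 2
  + 108%:R * (2%:R - q + q ^+ 2 - 2%:R * q ^+ 3) / ((1 + q + q ^+ 2) * (1 - q + q ^+ 2))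
  + 168%:R / (1 - q).
Proof.
have [a1 a2 a3 [a4 a5] [a6 a7]] := q_factors.
rewrite /hessian_data big_cat big_flatten big_map /=.
have N0 : {in free_data, forall d, normK t w e d != 0}.
  move=> d /(map_f (normK t w e)); rewrite (free_norms t w_sq e3) -/q.
  rewrite !inE => ND.
  by do ![case/orP: ND => ND | move/eqP: ND => ->]; rewrite ?mulf_neq0 ?expf_neq0.
rewrite (eq_big_seq _ (fun d fd => central_orbit_sum w_sq (N0 d fd))).
have := free_norms t w_sq e3; have := free_products w_sq e3; have := fixed_charK.
rewrite /free_data /fixed_data -/q /= => -[f1 f2 f3] [p1 p2 p3 p4 p5 p6 p7] [n1 n2 n3 n4 n5 n6 n7].
rewrite !big_cons !big_nil f1 f2 f3 p1 p2 p3 p4 p5 p6 p7 n1 n2 n3 n4 n5 n6 n7 /=.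
have t6 : t ^+ 6 = q ^+ 2 by rewrite /q -exprM.
rewrite t6.
(* With [1 + q + q^2 = x y], this is [y / x^2 + x / y^2 = (x^3 + y^3) / (x y)^2]. *)
have E1 : (1 + q + q ^+ 2) / (1 - (- 1 - w) * q) ^+ 3 + (1 + q + q ^+ 2) / (1 - w * q) ^+ 3 =
  (2%:R + 3%:R * q - 3%:R * q ^+ 2 - 2%:R * q ^+ 3) / (1 + q + q ^+ 2) ^+ 2.
  have -> : 1 + q + q ^+ 2 = (1 - (- 1 - w) * q) * (1 - w * q) by ring: w_sq.
  have -> : 2%:R + 3%:R * q - 3%:R * q ^+ 2 - 2%:R * q ^+ 3 =
    (1 - (- 1 - w) * q) ^+ 3 + (1 - w * q) ^+ 3 by ring: w_sq.
  move: a4 a5; generalize (1 - (- 1 - w) * q) (1 - w * q) => x y x0 y0.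
  by field; rewrite x0 y0.
have E2 : (1 - q + q ^+ 2) / ((1 - (- 1 - w) * q) * (1 + (- 1 - w) * q) ^+ 2)
    + (1 - q + q ^+ 2) / ((1 - w * q) * (1 + w * q) ^+ 2) =
  (2%:R - q + q ^+ 2 - 2%:R * q ^+ 3) / ((1 + q + q ^+ 2) * (1 - q + q ^+ 2)).
  have -> : 1 + q + q ^+ 2 = (1 - (- 1 - w) * q) * (1 - w * q) by ring: w_sq.
  have -> : 1 - q + q ^+ 2 = (1 + (- 1 - w) * q) * (1 + w * q) by ring: w_sq.
  have -> : 2%:R - q + q ^+ 2 - 2%:R * q ^+ 3 =
    (1 - (- 1 - w) * q) * (1 + (- 1 - w) * q) ^+ 2 + (1 - w * q) * (1 + w * q) ^+ 2.
    by ring: w_sq.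
  move: a4 a5 a6 a7; generalize (1 - (- 1 - w) * q) (1 - w * q) (1 + (- 1 - w) * q) (1 + w * q).
  by move=> x y u v x0 y0 u0 v0; field; rewrite x0 y0 u0 v0.
rewrite -![36%:R * _ / _]mulrA -![108%:R * _ / _]mulrA -E1 -E2.
(* With the inverses as indeterminates, a polynomial identity remains. *)
generalize ((1 - q) ^+ 3)^-1 ((1 - q) * (1 + q ^+ 2))^-1 ((1 + q) ^+ 2 * (1 - q))^-1 (1 - q)^-1.
generalize ((1 - (-1 - w) * q) ^+ 3)^-1 ((1 - w * q) ^+ 3)^-1.
generalize ((1 - (-1 - w) * q) * (1 + (-1 - w) * q) ^+ 2)^-1 ((1 - w * q) * (1 + w * q) ^+ 2)^-1.
move=> i1 i2 i3 i4 i5 i6 i7 i8; ring.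
Qed.

Lemma det_identity :
  2%:R != 0 :> K -> 3%:R != 0 :> K ->
  \prod_(d <- hessian_data) charK t w e d =
    (1 - t ^+ 3) ^+ 4 * (1 - t ^+ 6) * (1 - t ^+ 9) ^+ 2 / (1 - t ^+ 18)
      * Delta [:: 2; 3; 3; 3]%N (t ^+ 6)
  /\
  \prod_(d <- hessian_data) charK t w e d *
    (648%:R^-1 * \sum_(d <- hessian_data) d.1.1%:R / charK t w e d) =
    (1 - t ^+ 3) ^+ 4 * (1 - t ^+ 6) * (1 - t ^+ 9) / (1 - t ^+ 18)
      * DeltaP [:: 2; 3; 3; 3]%N (t ^+ 6).
Proof.
move=> two0 three0; rewrite data_prod data_sum.
have [a1 a2 a3 [a4 a5] [a6 a7]] := q_factors.
have b1 : 1 + q + q ^+ 2 != 0.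
  have -> : 1 + q + q ^+ 2 = (1 - (- 1 - w) * q) * (1 - w * q) by ring: w_sq.
  by rewrite mulf_neq0.
have b2 : 1 - q + q ^+ 2 != 0.
  have -> : 1 - q + q ^+ 2 = (1 + (- 1 - w) * q) * (1 + w * q) by ring: w_sq.
  by rewrite mulf_neq0.
have t6 : t ^+ 6 = q ^+ 2 by rewrite /q -exprM.
have t9 : t ^+ 9 = q ^+ 3 by rewrite /q -exprM.
have t18 : t ^+ 18 = q ^+ 6 by rewrite /q -exprM.
rewrite t6 t9 t18 -/q; move: q a1 a2 a3 b1 b2 {t6 t9 t18 a4 a5 a6 a7} => x a1 a2 a3 b1 b2.
have x2E : 1 - x ^+ 2 = (1 - x) * (1 + x) by ring.
have x6E : 1 - x ^+ 6 = (1 - x) * (1 + x) * (1 + x + x ^+ 2) * (1 - x + x ^+ 2) by ring.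
have x2 : 1 - x ^+ 2 != 0 by rewrite x2E mulf_neq0.
have x6 : 1 - x ^+ 6 != 0 by rewrite x6E !mulf_neq0.
split.
  rewrite /Delta !big_cons big_nil /= -!exprM [(2 * 2)%N]/= [(2 * 3)%N]/=.
  (* Four weights make the exponent [2 - m] negative. *)
  rewrite (_ : (1 - x ^+ 2) ^ (2%:Z - 4%:Z) = (1 - x ^+ 2) ^- 2) //.
  rewrite mulr1; field.
  by rewrite ?a1 ?a2 ?x2 ?x6 ?a3 ?b1 ?b2.
(* Turning the excluded index into a factor 1 lets [big_ord_recl] unfold the product. *)
have prodE (F : 'I_4 -> K) k : \prod_(l < 4 | l != k) F l =
    \prod_(l < 4) (if l != k then F l else 1) by rewrite big_mkcond.
have q1 : qint 1 (x ^+ 2) = 1 by rewrite /qint expr1 divff.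
have q2 : qint 2 (x ^+ 2) = 1 + x ^+ 2 by rewrite /qint; field.
have q3 : qint 3 (x ^+ 2) = 1 + x ^+ 2 + x ^+ 4 by rewrite /qint; field.
rewrite /DeltaP !big_cons big_nil !big_ord_recl !big_ord0 !prodE !big_ord_recl !big_ord0 /=.
rewrite !(q1, q2, q3).
have n648 : 648%:R != 0 :> K.
  by rewrite (_ : 648%:R = 2%:R ^+ 3 * 3%:R ^+ 4) ?mulf_neq0 ?expf_neq0 //; ring.
field.
by rewrite x6 a1 b2 b1 a2 a3 n648.
Qed.

End RationalFunctions.

(** * Specialisation to the field of rational functions in [Tf] *)

Definition fracC (a : algC) : {fraction {poly algC}} := tofrac a%:P.

Lemma fracC_is_zmod_morphism : zmod_morphism fracC.
Proof. by move=> a b; rewrite /fracC polyCB tofracB. Qed.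
HB.instance Definition _ := GRing.isZmodMorphism.Build algC {fraction {poly algC}}
  fracC fracC_is_zmod_morphism.

Lemma fracC_is_monoid_morphism : monoid_morphism fracC.
Proof. by split=> [|a b]; rewrite /fracC ?polyC1 ?tofrac1 // polyCM tofracM. Qed.
HB.instance Definition _ := GRing.isMonoidMorphism.Build algC {fraction {poly algC}}
  fracC fracC_is_monoid_morphism.

Lemma trK_rmorph (K : fieldType) (f : {rmorphism algC -> K}) eps (x : nat * eis) :
  f (eps ^+ x.1 * ev x.2) = trK (f omega) (f eps) x.
Proof. by rewrite rmorphM rmorphXn /= /ev rmorphD rmorphM /= !rmorph_int. Qed.

Lemma Tf_neq1 k : Tf ^+ k.+1 != 1.
Proof.
rewrite /Tf -tofracXn -tofrac1 tofrac_eq; apply/eqP=> /(congr1 (fun p : {poly algC} => size p)).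
by rewrite size_polyXn size_poly1.
Qed.

Section HessianGroup.
Variables (gT : finGroupType) (G : {group gT}).
Variables (rho : mx_representation algC G 3) (eps : algC).
Hypothesis eps3 : eps ^+ 3 = omega ^+ 2.
Hypothesis rho_inj : {in G &, injective rho}.
Hypothesis rho_gen : forall A : 'M[algC]_3,
  (exists2 g, g \in G & rho g = A) <-> gen_by [:: HS1; HT0; HV; HU eps] A.

Lemma tofrac_mckay_factor u : u \in cwords ->
  tofrac (mckay_factor rho (of_code rho eps (weval u))) =
  charK Tf (fracC omega) (fracC eps) (wdatum u).
Proof.
move=> cu; have [Ea Eb] := chi_of_code eps3 rho_inj rho_gen cwordsP wevalVP cu.
rewrite /mckay_factor /charK /char3 -!trK_rmorph /= -Ea -Eb /fracC /Tf.
by rewrite -!tofracXn -!tofracM -tofrac1 -!tofracB -tofracD !mul_polyC.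
Qed.

Lemma card_G : #|G| = 648%N.
Proof.
rewrite cardE (perm_size (perm_enum_G eps3 rho_inj rho_gen cwordsP class_tableP)).
rewrite size_map size_flatten.
have -> : shape [seq wclass 100 u | u <- cwords] =
    [seq d.1.1 | d <- [seq wdatum u | u <- cwords]].
  by rewrite /shape -[LHS]map_comp -[RHS]map_comp; apply: eq_map; exact: size_wdatum.
by rewrite class_data.
Qed.

End HessianGroup.

Theorem theorem2 (gT : finGroupType) (G : {group gT})
    (rho : mx_representation algC G 3) (eps : algC) :
  eps ^+ 3 = omega ^+ 2 ->
  {in G &, injective rho} ->
  (forall A : 'M[algC]_3,
     (exists2 g, g \in G & rho g = A) <-> gen_by [:: HS1; HT0; HV; HU eps] A) ->
  (\det (M0mat rho))%:F =
    (1 - Tf ^+ 3) ^+ 4 * (1 - Tf ^+ 6) * (1 - Tf ^+ 9) / (1 - Tf ^+ 18)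
      * DeltaP [:: 2; 3; 3; 3]%N (Tf ^+ 6)
  /\
  (\det (Mmat rho))%:F =
    (1 - Tf ^+ 3) ^+ 4 * (1 - Tf ^+ 6) * (1 - Tf ^+ 9) ^+ 2 / (1 - Tf ^+ 18)
      * Delta [:: 2; 3; 3; 3]%N (Tf ^+ 6).
Proof.
move=> eps3 rho_inj rho_gen.
have w_sq : fracC omega ^+ 2 = - 1 - fracC omega.
  by rewrite -rmorphXn omega_sq rmorphB rmorphN rmorph1.
have e3 : fracC eps ^+ 3 = fracC omega ^+ 2 by rewrite -!rmorphXn eps3.
have nat_neq0 n : (n.+1)%:R != 0 :> {fraction {poly algC}}.
  by rewrite -(rmorph_nat fracC) fmorph_eq0 pnatr_eq0.
have [detE det0E] := det_identity w_sq e3 Tf_neq1 (nat_neq0 1%N) (nat_neq0 2%N).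
have E1 : (\det (Mmat rho))%:F =
  \prod_(d <- hessian_data)
    charK Tf (fracC omega) (fracC eps) d.
  rewrite det_Mmat (prod_classes eps3 rho_inj rho_gen cwordsP class_tableP (mckay_factorJ rho)).
  rewrite rmorph_prod -class_data big_map; apply: eq_big_seq => u cu.
  exact: tofrac_mckay_factor.
split; last by rewrite E1 detE.
(* It remains to match the Molien sum over [G] with the sum over the class data weighted by class
   sizes. *)
rewrite -det0E det_M0mat E1 (card_G eps3 rho_inj rho_gen); congr (_ * (_ * _)).
rewrite (sum_group eps3 rho_inj rho_gen cwordsP class_tableP
  (F := fun g => (mckay_factor rho g)%:F^-1)); last first.
  by move=> g h Gg Gh; rewrite mckay_factorJ.
rewrite -class_data big_map; apply: eq_big_seq => u cu.
by rewrite size_wdatum (tofrac_mckay_factor eps3 rho_inj rho_gen cu).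
Qed.
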